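(* Let $\mathcal{Q}$ be a small quantaloid. For each $\mathcal{Q}$-functor $F:\mathbb{A}\to\mathbb{B}$ between $\mathcal{Q}$-categories, it holds that $$F^{\rightarrow}=(F^{\natural})^*\dashv (F^{\natural})_*= F^{\leftarrow}=(F_{\natural})^*\dashv(F_{\natural})_*$$ and $$(F^{\natural})_{\dagger}\dashv (F^{\natural})^{\dagger}=F^{\nleftarrow}=(F_{\natural})_{\dagger}\dashv(F_{\natural})^{\dagger}=F^{\nrightarrow},$$ where $\dashv$ denotes adjunction of $\mathcal{Q}$-functors (left adjoint on the left).
   Context: A quantaloid $\mathcal{Q}$ is a category whose hom-sets are complete lattices and whose composition preserves arbitrary joins in each variable; it is small if its objects $\mathcal{Q}_0$ and arrows form sets. For $f:X\to Y$, $g:Y\to Z$, $h:X\to Z$ in a quantaloid, $h\swarrow f:Y\to Z$ is the largest arrow with $(h\swarrow f)\circ f\le h$, and $g\searrow h:X\to Y$ is the largest arrow with $g\circ(g\searrow h)\le h$. A $\mathcal{Q}$-category $\mathbb{A}$ is a set $\mathbb{A}_0$ with a type map $t:\mathbb{A}_0\to\mathcal{Q}_0$ and hom-arrows $\mathbb{A}(x,y)\in\mathcal{Q}(tx,ty)$ with $1_{tx}\le\mathbb{A}(x,x)$ and $\mathbb{A}(y,z)\circ\mathbb{A}(x,y)\le\mathbb{A}(x,z)$. A $\mathcal{Q}$-functor $F:\mathbb{A}\to\mathbb{B}$ is a type-preserving map with $\mathbb{A}(x,x')\le\mathbb{B}(Fx,Fx')$. The underlying preorder on $\mathbb{A}_0$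 is: $x\le y$ iff $tx=ty$ and $1_{tx}\le\mathbb{A}(x,y)$; $\mathcal{Q}$-functors are ordered pointwise. An adjunction $F\dashv G$ of $\mathcal{Q}$-functors $F:\mathbb{A}\to\mathbb{B}$, $G:\mathbb{B}\to\mathbb{A}$ means $1_{\mathbb{A}}\le G\circ F$ and $F\circ G\le 1_{\mathbb{B}}$. A $\mathcal{Q}$-distributor $\phi:\mathbb{A}\rightsquigarrow\mathbb{B}$ assigns to each $(x,y)\in\mathbb{A}_0\times\mathbb{B}_0$ an arrow $\phi(x,y)\in\mathcal{Q}(tx,ty)$ with $\mathbb{B}(y',y)\circ\phi(x,y')\le\phi(x,y)$ and $\phi(x',y)\circ\mathbb{A}(x,x')\le\phi(x,y)$. $\mathcal{Q}$-categories and $\mathcal{Q}$-distributors form a quantaloid with pointwise order, composition $(\psi\circ\phi)(x,z)=\bigvee_y\psi(y,z)\circ\phi(x,y)$, identities given by hom-arrows, and implications $(\eta\swarrow\phi)(y,z)=\bigwedge_x\eta(x,z)\swarrow\phi(x,y)$, $(\psi\searrow\eta)(x,y)=\bigwedge_z\psi(y,z)\searrow\eta(x,z)$. For $X\in\mathcal{Q}_0$, $*_X$ is the $\mathcal{Q}$-category with one object of type $X$ and hom-arrow $1_X$. $\mathcal{P}\mathbb{A}$ has as objects of type $X$ the distributors $\mu:\mathbb{A}\rightsquigarrow *_X$, with $\mathcal{P}\mathbb{A}(\mu,\lambda)=\lambda\swarrow\mu$. $\mathcal{P}^{\dagger}\mathbb{A}$ has as objects of type $X$ the distributors $\mu:*_X\rightsquigarrow\mathbb{A}$,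 with $\mathcal{P}^{\dagger}\mathbb{A}(\mu,\lambda)=\lambda\searrow\mu$. For a distributor $\phi:\mathbb{A}\rightsquigarrow\mathbb{B}$: $\phi^*:\mathcal{P}\mathbb{B}\to\mathcal{P}\mathbb{A}$, $\phi^*(\lambda)=\lambda\circ\phi$; $\phi_*:\mathcal{P}\mathbb{A}\to\mathcal{P}\mathbb{B}$, $\phi_*(\mu)=\mu\swarrow\phi$; $\phi^{\dagger}:\mathcal{P}^{\dagger}\mathbb{A}\to\mathcal{P}^{\dagger}\mathbb{B}$, $\phi^{\dagger}(\mu)=\phi\circ\mu$; $\phi_{\dagger}:\mathcal{P}^{\dagger}\mathbb{B}\to\mathcal{P}^{\dagger}\mathbb{A}$, $\phi_{\dagger}(\lambda)=\phi\searrow\lambda$. For a $\mathcal{Q}$-functor $F:\mathbb{A}\to\mathbb{B}$: the graph $F_{\natural}:\mathbb{A}\rightsquigarrow\mathbb{B}$ is $F_{\natural}(x,y)=\mathbb{B}(Fx,y)$; the cograph $F^{\natural}:\mathbb{B}\rightsquigarrow\mathbb{A}$ is $F^{\natural}(y,x)=\mathbb{B}(y,Fx)$. The image functors are $F^{\rightarrow}:\mathcal{P}\mathbb{A}\to\mathcal{P}\mathbb{B}$, $F^{\rightarrow}(\mu)=\mu\circ F^{\natural}$; $F^{\leftarrow}:\mathcal{P}\mathbb{B}\to\mathcal{P}\mathbb{A}$, $F^{\leftarrow}(\lambda)=\lambda\circ F_{\natural}$; $F^{\nrightarrow}:\mathcal{P}^{\dagger}\mathbb{A}\to\mathcal{P}^{\dagger}\mathbb{B}$,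 $F^{\nrightarrow}(\mu)=F_{\natural}\circ\mu$; $F^{\nleftarrow}:\mathcal{P}^{\dagger}\mathbb{B}\to\mathcal{P}^{\dagger}\mathbb{A}$, $F^{\nleftarrow}(\lambda)=F^{\natural}\circ\lambda$. *)

(* Defs.v *)
From Corelib Require Import ssreflect ssrfun ssrbool.

Set Implicit Arguments.
Unset Strict Implicit.
Unset Printing Implicit Defensive.

Declare Scope quantaloid_scope.

(* [join S] is the join of an arbitrary set [S] of parallel arrows; meets are
   derived from joins below.  [comp g f] is "g after f". *)
Structure quantaloid := Quantaloid {
  qobj :> Type;
  arr : qobj -> qobj -> Type;
  arr_le : forall X Y, arr X Y -> arr X Y -> Prop;
  join : forall X Y, (arr X Y -> Prop) -> arr X Y;
  idq : forall X, arr X X;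
  comp : forall X Y Z, arr Y Z -> arr X Y -> arr X Z;
  arr_le_refl : forall X Y (f : arr X Y), arr_le f f;
  arr_le_trans : forall X Y (f g h : arr X Y),
    arr_le f g -> arr_le g h -> arr_le f h;
  arr_le_anti : forall X Y (f g : arr X Y), arr_le f g -> arr_le g f -> f = g;
  join_ub : forall X Y (S : arr X Y -> Prop) f, S f -> arr_le f (join S);
  join_least : forall X Y (S : arr X Y -> Prop) g,
    (forall f, S f -> arr_le f g) -> arr_le (join S) g;
  compA : forall X Y Z W (h : arr Z W) (g : arr Y Z) (f : arr X Y),
    comp h (comp g f) = comp (comp h g) f;
  comp1q : forall X Y (f : arr X Y), comp (idq Y) f = f;
  compq1 : forall X Y (f : arr X Y), comp f (idq X) = f;
  comp_joinl : forall X Y Z (S : arr Y Z -> Prop) (f : arr X Y),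
    comp (join S) f = join (fun h => exists2 g, S g & h = comp g f);
  comp_joinr : forall X Y Z (g : arr Y Z) (S : arr X Y -> Prop),
    comp g (join S) = join (fun h => exists2 f, S f & h = comp g f)
}.

Arguments idq {q} X.
Arguments arr_le_refl {q X Y f}.

Notation "f <= g" := (arr_le f g) : quantaloid_scope.
Notation "g \o f" := (comp g f) : quantaloid_scope.
Local Open Scope quantaloid_scope.

Section Arrows.
Variable Q : quantaloid.
Implicit Types X Y Z W : Q.

Definition sup X Y (I : Type) (f : I -> arr X Y) : arr X Y :=
  join (fun g => exists i, g = f i).

Definition inf X Y (I : Type) (f : I -> arr X Y) : arr X Y :=
  join (fun g => forall i, g <= f i).

(* [limp h f] is the left implication (h swarrow f), and [rimp g h] is the
   right implication (g searrow h); see [limpP] and [rimpP]. *)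
Definition limp X Y Z (h : arr X Z) (f : arr X Y) : arr Y Z :=
  join (fun g => g \o f <= h).

Definition rimp X Y Z (g : arr Y Z) (h : arr X Z) : arr X Y :=
  join (fun f => g \o f <= h).

Lemma sup_ub X Y (I : Type) (f : I -> arr X Y) i : f i <= sup f.
Proof. by apply: join_ub; exists i. Qed.

Lemma sup_least X Y (I : Type) (f : I -> arr X Y) g :
  (forall i, f i <= g) -> sup f <= g.
Proof. by move=> fg; apply: join_least => _ [i ->]. Qed.

Lemma inf_lb X Y (I : Type) (f : I -> arr X Y) i : inf f <= f i.
Proof. by apply: join_least => g; apply. Qed.

Lemma inf_greatest X Y (I : Type) (f : I -> arr X Y) g :
  (forall i, g <= f i) -> g <= inf f.
Proof. by move=> gf; apply: join_ub. Qed.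

Lemma comp_le2l X Y Z (g : arr Y Z) (f f' : arr X Y) :
  f <= f' -> g \o f <= g \o f'.
Proof.
move=> ff'; have -> : f' = join (fun h => h <= f').
  apply: arr_le_anti; last by apply: join_least.
  by apply: join_ub; apply: arr_le_refl.
by rewrite comp_joinr; apply: join_ub; exists f.
Qed.

Lemma comp_le2r X Y Z (g g' : arr Y Z) (f : arr X Y) :
  g <= g' -> g \o f <= g' \o f.
Proof.
move=> gg'; have -> : g' = join (fun h => h <= g').
  apply: arr_le_anti; last by apply: join_least.
  by apply: join_ub; apply: arr_le_refl.
by rewrite comp_joinl; apply: join_ub; exists g.
Qed.

Lemma limpP X Y Z (h : arr X Z) (f : arr X Y) (g : arr Y Z) :
  g <= limp h f <-> g \o f <= h.
Proof.
split=> [/(comp_le2r f) gh|gfh]; last exact: join_ub.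
apply: (arr_le_trans gh); rewrite /limp comp_joinl.
by apply: join_least => _ [k kf ->].
Qed.

Lemma rimpP X Y Z (g : arr Y Z) (h : arr X Z) (f : arr X Y) :
  f <= rimp g h <-> g \o f <= h.
Proof.
split=> [/(comp_le2l g) fh|gfh]; last exact: join_ub.
apply: (arr_le_trans fh); rewrite /rimp comp_joinr.
by apply: join_least => _ [k gk ->].
Qed.

Lemma limp_comp X Y Z (h : arr X Z) (f : arr X Y) : limp h f \o f <= h.
Proof. by apply/limpP; apply: arr_le_refl. Qed.

Lemma rimp_comp X Y Z (g : arr Y Z) (h : arr X Z) : g \o rimp g h <= h.
Proof. by apply/rimpP; apply: arr_le_refl. Qed.

Lemma sup_compl X Y Z (I : Type) (g : I -> arr Y Z) (f : arr X Y) h :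
  (forall i, g i \o f <= h) -> sup g \o f <= h.
Proof. by move=> gh; apply/limpP; apply: sup_least => i; apply/limpP. Qed.

Lemma sup_compr X Y Z (I : Type) (g : arr Y Z) (f : I -> arr X Y) h :
  (forall i, g \o f i <= h) -> g \o sup f <= h.
Proof. by move=> fh; apply/rimpP; apply: sup_least => i; apply/rimpP. Qed.

(* Transport of arrows along equalities of types: functors preserve types only
   up to a propositional equality [t (F x) = t x]. *)
Definition castarr X X' Y Y' (eX : X = X') (eY : Y = Y') (f : arr X Y) :
    arr X' Y' :=
  match eX in _ = X0, eY in _ = Y0 return arr X0 Y0 with
  | erefl, erefl => f
  end.

Lemma castarr_le X X' Y Y' (eX : X = X') (eY : Y = Y') (f g : arr X Y) :
  f <= g -> castarr eX eY f <= castarr eX eY g.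
Proof. by case: _ / eX; case: _ / eY. Qed.

Lemma castarr_comp X X' Y Y' Z Z' (eX : X = X') (eY : Y = Y') (eZ : Z = Z')
    (g : arr Y Z) (f : arr X Y) :
  castarr eY eZ g \o castarr eX eY f = castarr eX eZ (g \o f).
Proof. by case: _ / eX; case: _ / eY; case: _ / eZ. Qed.

Lemma castarr_id X X' (eX : X = X') : castarr eX eX (idq X) = idq X'.
Proof. by case: _ / eX. Qed.

Lemma castarr_trans X X' X'' Y Y' Y'' (eX : X = X') (eX' : X' = X'')
    (eY : Y = Y') (eY' : Y' = Y'') (f : arr X Y) :
  castarr (etrans eX eX') (etrans eY eY') f =
  castarr eX' eY' (castarr eX eY f).
Proof. by case: _ / eX'; case: _ / eY'. Qed.

End Arrows.

Section Categories.
Variable Q : quantaloid.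

Structure qcat := QCat {
  qcat_ob :> Type;
  qtype : qcat_ob -> Q;
  qhom : forall x y : qcat_ob, arr (qtype x) (qtype y);
  qhom_id : forall x, idq (qtype x) <= qhom x x;
  qhom_comp : forall x y z, qhom y z \o qhom x y <= qhom x z
}.

Structure qfunctor (A B : qcat) := QFunctor {
  qfun :> A -> B;
  qfun_type : forall x, qtype (qfun x) = qtype x;
  qfun_hom : forall x x',
    qhom x x' <= castarr (qfun_type x) (qfun_type x') (qhom (qfun x) (qfun x'))
}.

(* The underlying preorder: [x] and [y] have the same type and 1 <= A(x, y). *)
Definition qle (A : qcat) (x y : A) : Prop :=
  exists e : qtype y = qtype x,
    idq (qtype x) <= castarr erefl e (qhom x y).

Definition qfunctor_le (A B : qcat) (F G : qfunctor A B) : Prop :=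
  forall x, qle (F x) (G x).

Definition qfunctor_id (A : qcat) : qfunctor A A :=
  @QFunctor A A (fun x => x) (fun x => erefl) (fun x x' => arr_le_refl).

Lemma qfunctor_comp_subproof (A B C : qcat) (G : qfunctor B C)
    (F : qfunctor A B) x x' :
  qhom x x' <= castarr (etrans (qfun_type G (F x)) (qfun_type F x))
                       (etrans (qfun_type G (F x')) (qfun_type F x'))
                       (qhom (G (F x)) (G (F x'))).
Proof.
rewrite castarr_trans; apply: (arr_le_trans (qfun_hom F x x')).
by apply: castarr_le; apply: qfun_hom.
Qed.

Definition qfunctor_comp (A B C : qcat) (G : qfunctor B C) (F : qfunctor A B) :
    qfunctor A C :=
  @QFunctor A C (fun x => G (F x)) _ (qfunctor_comp_subproof G F).

Definition qadjoint (A B : qcat) (F : qfunctor A B) (G : qfunctor B A) : Prop :=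
  qfunctor_le (qfunctor_id A) (qfunctor_comp G F) /\
  qfunctor_le (qfunctor_comp F G) (qfunctor_id B).

Structure dist (A B : qcat) := Dist {
  dist_arr :> forall (x : A) (y : B), arr (qtype x) (qtype y);
  dist_actl : forall x y' y, qhom y' y \o dist_arr x y' <= dist_arr x y;
  dist_actr : forall x x' y, dist_arr x' y \o qhom x x' <= dist_arr x y
}.

Section DistOperations.
Variables A B C : qcat.

Definition dcomp_arr (psi : dist B C) (phi : dist A B) (x : A) (z : C) :=
  sup (fun y : B => psi y z \o phi x y).

Lemma dcomp_actl (psi : dist B C) (phi : dist A B) x z' z :
  qhom z' z \o dcomp_arr psi phi x z' <= dcomp_arr psi phi x z.
Proof.
apply: sup_compr => y; rewrite compA.
apply: (@arr_le_trans _ _ _ _ (psi y z \o phi x y)); last first.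
  exact: (sup_ub (fun y => psi y z \o phi x y)).
by apply: comp_le2r; apply: dist_actl.
Qed.

Lemma dcomp_actr (psi : dist B C) (phi : dist A B) x x' z :
  dcomp_arr psi phi x' z \o qhom x x' <= dcomp_arr psi phi x z.
Proof.
apply: sup_compl => y; rewrite -compA.
apply: (@arr_le_trans _ _ _ _ (psi y z \o phi x y)); last first.
  exact: (sup_ub (fun y => psi y z \o phi x y)).
by apply: comp_le2l; apply: dist_actr.
Qed.

Definition dcomp (psi : dist B C) (phi : dist A B) : dist A C :=
  Dist (dcomp_actl psi phi) (dcomp_actr psi phi).

Definition dlimp_arr (eta : dist A C) (phi : dist A B) (y : B) (z : C) :=
  inf (fun x : A => limp (eta x z) (phi x y)).

Lemma dlimp_actl (eta : dist A C) (phi : dist A B) y z' z :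
  qhom z' z \o dlimp_arr eta phi y z' <= dlimp_arr eta phi y z.
Proof.
apply: inf_greatest => x; apply/limpP.
apply: (arr_le_trans _ (dist_actl eta x z' z)); rewrite -compA.
apply: comp_le2l; apply/limpP.
exact: (inf_lb (fun x => limp (eta x z') (phi x y))).
Qed.

Lemma dlimp_actr (eta : dist A C) (phi : dist A B) y y' z :
  dlimp_arr eta phi y' z \o qhom y y' <= dlimp_arr eta phi y z.
Proof.
apply: inf_greatest => x; apply/limpP; rewrite -compA.
apply: (@arr_le_trans _ _ _ _ (dlimp_arr eta phi y' z \o phi x y')).
  by apply: comp_le2l; apply: dist_actl.
by apply/limpP; apply: (inf_lb (fun x => limp (eta x z) (phi x y'))).
Qed.

Definition dlimp (eta : dist A C) (phi : dist A B) : dist B C :=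
  Dist (dlimp_actl eta phi) (dlimp_actr eta phi).

Definition drimp_arr (psi : dist B C) (eta : dist A C) (x : A) (y : B) :=
  inf (fun z : C => rimp (psi y z) (eta x z)).

Lemma drimp_actl (psi : dist B C) (eta : dist A C) x y' y :
  qhom y' y \o drimp_arr psi eta x y' <= drimp_arr psi eta x y.
Proof.
apply: inf_greatest => z; apply/rimpP; rewrite compA.
apply: (@arr_le_trans _ _ _ _ (psi y' z \o drimp_arr psi eta x y')).
  by apply: comp_le2r; apply: dist_actr.
by apply/rimpP; apply: (inf_lb (fun z => rimp (psi y' z) (eta x z))).
Qed.

Lemma drimp_actr (psi : dist B C) (eta : dist A C) x x' y :
  drimp_arr psi eta x' y \o qhom x x' <= drimp_arr psi eta x y.
Proof.
apply: inf_greatest => z; apply/rimpP; rewrite compA.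
apply: (arr_le_trans _ (dist_actr eta x x' z)).
apply: comp_le2r; apply/rimpP.
exact: (inf_lb (fun z => rimp (psi y z) (eta x' z))).
Qed.

Definition drimp (psi : dist B C) (eta : dist A C) : dist A B :=
  Dist (drimp_actl psi eta) (drimp_actr psi eta).

End DistOperations.

Lemma qstar_comp_subproof (X : Q) (x y z : unit) : idq X \o idq X <= idq X.
Proof. by rewrite comp1q; apply: arr_le_refl. Qed.

Definition qstar (X : Q) : qcat :=
  @QCat unit (fun=> X) (fun _ _ => idq X) (fun=> arr_le_refl)
    (@qstar_comp_subproof X).

Section Presheaves.
Variable A : qcat.

(* Presheaves [mu : A ~> *_X] and copresheaves [mu : *_X ~> A].  Both have
   hom-arrows from [mu] to [lam]; on copresheaves the underlying preorder is
   therefore the reverse of the pointwise order. *)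
Structure psh := Psh {
  psh_type : Q;
  psh_dist :> dist A (qstar psh_type)
}.

Definition psh_hom (mu lam : psh) : arr (psh_type mu) (psh_type lam) :=
  dlimp lam mu tt tt.

Lemma psh_homP (mu lam : psh) (u : arr (psh_type mu) (psh_type lam)) :
  u <= psh_hom mu lam <-> (forall x, u \o mu x tt <= lam x tt).
Proof.
split=> [uml x|uml]; last by apply: inf_greatest => x; apply/limpP.
apply/limpP; apply: (arr_le_trans uml).
exact: (inf_lb (fun x => limp (lam x tt) (mu x tt))).
Qed.

Lemma psh_hom_id (mu : psh) : idq (psh_type mu) <= psh_hom mu mu.
Proof. by apply/psh_homP => x; rewrite comp1q; apply: arr_le_refl. Qed.

Lemma psh_hom_comp (mu lam nu : psh) :
  psh_hom lam nu \o psh_hom mu lam <= psh_hom mu nu.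
Proof.
apply/psh_homP => x; rewrite -compA.
apply: (@arr_le_trans _ _ _ _ (psh_hom lam nu \o lam x tt)).
  by apply: comp_le2l; move: x; apply/psh_homP; apply: arr_le_refl.
by move: x; apply/psh_homP; apply: arr_le_refl.
Qed.

Definition PSh : qcat := QCat psh_hom_id psh_hom_comp.

Structure copsh := Copsh {
  copsh_type : Q;
  copsh_dist :> dist (qstar copsh_type) A
}.

Definition copsh_hom (mu lam : copsh) :
    arr (copsh_type mu) (copsh_type lam) :=
  drimp lam mu tt tt.

Lemma copsh_homP (mu lam : copsh) (u : arr (copsh_type mu) (copsh_type lam)) :
  u <= copsh_hom mu lam <-> (forall x, lam tt x \o u <= mu tt x).
Proof.
split=> [uml x|uml]; last by apply: inf_greatest => x; apply/rimpP.
apply/rimpP; apply: (arr_le_trans uml).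
exact: (inf_lb (fun x => rimp (lam tt x) (mu tt x))).
Qed.

Lemma copsh_hom_id (mu : copsh) : idq (copsh_type mu) <= copsh_hom mu mu.
Proof. by apply/copsh_homP => x; rewrite compq1; apply: arr_le_refl. Qed.

Lemma copsh_hom_comp (mu lam nu : copsh) :
  copsh_hom lam nu \o copsh_hom mu lam <= copsh_hom mu nu.
Proof.
apply/copsh_homP => x; rewrite compA.
apply: (@arr_le_trans _ _ _ _ (lam tt x \o copsh_hom mu lam)).
  by apply: comp_le2r; move: x; apply/copsh_homP; apply: arr_le_refl.
by move: x; apply/copsh_homP; apply: arr_le_refl.
Qed.

Definition CoPSh : qcat := QCat copsh_hom_id copsh_hom_comp.

End Presheaves.

Section DistFunctors.
Variables (A B : qcat) (phi : dist A B).

Definition dist_pre_fun (lam : psh B) : psh A := Psh (dcomp lam phi).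

Lemma dist_pre_hom (mu lam : psh B) :
  psh_hom mu lam <= psh_hom (dist_pre_fun mu) (dist_pre_fun lam).
Proof.
apply/(@psh_homP _ (dist_pre_fun mu) (dist_pre_fun lam)) => x; apply: sup_compr => y; rewrite compA.
apply: (@arr_le_trans _ _ _ _ (lam y tt \o phi x y)); last first.
  exact: (sup_ub (fun y => lam y tt \o phi x y)).
apply: comp_le2r; move: y; apply/psh_homP; exact: arr_le_refl.
Qed.

(* phi^* : lam |-> lam o phi *)
Definition dist_upstar : qfunctor (PSh B) (PSh A) :=
  @QFunctor (PSh B) (PSh A) dist_pre_fun (fun=> erefl) dist_pre_hom.

Definition dist_ran_fun (mu : psh A) : psh B := Psh (dlimp mu phi).

Lemma dist_ran_hom (mu lam : psh A) :
  psh_hom mu lam <= psh_hom (dist_ran_fun mu) (dist_ran_fun lam).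
Proof.
apply/(@psh_homP _ (dist_ran_fun mu) (dist_ran_fun lam)) => y; apply: inf_greatest => x; apply/limpP; rewrite -compA.
apply: (@arr_le_trans _ _ _ _ (psh_hom mu lam \o mu x tt)).
  apply: comp_le2l; apply/limpP.
  exact: (inf_lb (fun x => limp (mu x tt) (phi x y))).
by move: x; apply/psh_homP; apply: arr_le_refl.
Qed.

(* phi_* : mu |-> mu swarrow phi *)
Definition dist_lowstar : qfunctor (PSh A) (PSh B) :=
  @QFunctor (PSh A) (PSh B) dist_ran_fun (fun=> erefl) dist_ran_hom.

Definition dist_post_fun (mu : copsh A) : copsh B := Copsh (dcomp phi mu).

Lemma dist_post_hom (mu lam : copsh A) :
  copsh_hom mu lam <=
  copsh_hom (dist_post_fun mu) (dist_post_fun lam).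
Proof.
apply/(@copsh_homP _ (dist_post_fun mu) (dist_post_fun lam)) => y; apply: sup_compl => x; rewrite -compA.
apply: (@arr_le_trans _ _ _ _ (phi x y \o mu tt x)); last first.
  exact: (sup_ub (fun x => phi x y \o mu tt x)).
apply: comp_le2l; move: x; apply/copsh_homP; exact: arr_le_refl.
Qed.

(* phi^dagger : mu |-> phi o mu *)
Definition dist_updagger : qfunctor (CoPSh A) (CoPSh B) :=
  @QFunctor (CoPSh A) (CoPSh B) dist_post_fun (fun=> erefl) dist_post_hom.

Definition dist_lift_fun (lam : copsh B) : copsh A := Copsh (drimp phi lam).

Lemma dist_lift_hom (mu lam : copsh B) :
  copsh_hom mu lam <=
  copsh_hom (dist_lift_fun mu) (dist_lift_fun lam).
Proof.
apply/(@copsh_homP _ (dist_lift_fun mu) (dist_lift_fun lam)) => x; apply: inf_greatest => y; apply/rimpP; rewrite compA.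
apply: (@arr_le_trans _ _ _ _ (lam tt y \o copsh_hom mu lam)).
  apply: comp_le2r; apply/rimpP.
  exact: (inf_lb (fun y => rimp (phi x y) (lam tt y))).
by move: y; apply/copsh_homP; apply: arr_le_refl.
Qed.

(* phi_dagger : lam |-> phi searrow lam *)
Definition dist_lowdagger : qfunctor (CoPSh B) (CoPSh A) :=
  @QFunctor (CoPSh B) (CoPSh A) dist_lift_fun (fun=> erefl) dist_lift_hom.

End DistFunctors.

Section Graphs.
Variables (A B : qcat) (F : qfunctor A B).

Definition graph_arr (x : A) (y : B) : arr (qtype x) (qtype y) :=
  castarr (qfun_type F x) erefl (qhom (F x) y).

Lemma graph_actl x y' y : qhom y' y \o graph_arr x y' <= graph_arr x y.
Proof.
rewrite -[qhom y' y]/(castarr erefl erefl (qhom y' y)) castarr_comp.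
by apply: castarr_le; apply: qhom_comp.
Qed.

Lemma graph_actr x x' y : graph_arr x' y \o qhom x x' <= graph_arr x y.
Proof.
apply: (arr_le_trans (comp_le2l _ (qfun_hom F x x'))).
by rewrite castarr_comp; apply: castarr_le; apply: qhom_comp.
Qed.

Definition graph : dist A B := Dist graph_actl graph_actr.

Definition cograph_arr (y : B) (x : A) : arr (qtype y) (qtype x) :=
  castarr erefl (qfun_type F x) (qhom y (F x)).

Lemma cograph_actl y x' x : qhom x' x \o cograph_arr y x' <= cograph_arr y x.
Proof.
apply: (arr_le_trans (comp_le2r _ (qfun_hom F x' x))).
by rewrite castarr_comp; apply: castarr_le; apply: qhom_comp.
Qed.

Lemma cograph_actr y y' x : cograph_arr y' x \o qhom y y' <= cograph_arr y x.
Proof.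
rewrite -[qhom y y']/(castarr erefl erefl (qhom y y')) castarr_comp.
by apply: castarr_le; apply: qhom_comp.
Qed.

Definition cograph : dist B A := Dist cograph_actl cograph_actr.

End Graphs.

(* [image], [preimage], [coimage] and [copreimage] are respectively
   F^rightarrow, F^leftarrow, F^nrightarrow and F^nleftarrow. *)
Section ImageFunctors.
Variables (A B : qcat) (F : qfunctor A B).

Definition image : qfunctor (PSh A) (PSh B) :=
  @QFunctor (PSh A) (PSh B) (fun mu => Psh (dcomp mu (cograph F)))
    (fun=> erefl) (dist_pre_hom (cograph F)).

Definition preimage : qfunctor (PSh B) (PSh A) :=
  @QFunctor (PSh B) (PSh A) (fun lam => Psh (dcomp lam (graph F)))
    (fun=> erefl) (dist_pre_hom (graph F)).

Definition coimage : qfunctor (CoPSh A) (CoPSh B) :=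
  @QFunctor (CoPSh A) (CoPSh B) (fun mu => Copsh (dcomp (graph F) mu))
    (fun=> erefl) (dist_post_hom (graph F)).

Definition copreimage : qfunctor (CoPSh B) (CoPSh A) :=
  @QFunctor (CoPSh B) (CoPSh A) (fun lam => Copsh (dcomp (cograph F) lam))
    (fun=> erefl) (dist_post_hom (cograph F)).

End ImageFunctors.

End Categories.

(* Main.v *)
From Corelib Require Import ssreflect ssrfun ssrbool.
From Stdlib Require Import FunctionalExtensionality ProofIrrelevance.
Require Import Defs.

(** The graph is left adjoint to the cograph in the quantaloid of distributors,
    and for any adjoint pair [phi -| psi] of distributors, [- swarrow psi]
    coincides with [- o phi] and [phi searrow -] coincides with [psi o -].
    These identities give the equalities between functors; the adjunctions
    are residuation. *)

Set Implicit Arguments.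
Unset Strict Implicit.
Unset Printing Implicit Defensive.

Local Open Scope quantaloid_scope.

Section Extensionality.
Variable Q : quantaloid.

Lemma dist_ext (A B : qcat Q) (phi psi : dist A B) :
  (forall x y, phi x y = psi x y) -> phi = psi.
Proof.
case: phi psi => [f fl fr] [g gl gr] /= fg.
have e : f = g.
  by apply: functional_extensionality_dep => x;
     apply: functional_extensionality_dep.
case: _ / e gl gr => gl gr.
by rewrite (proof_irrelevance _ fl gl) (proof_irrelevance _ fr gr).
Qed.

Lemma qfunctor_ext (A B : qcat Q) (F G : qfunctor A B) :
  (forall x, F x = G x) -> F = G.
Proof.
case: F G => [f ft fh] [g gt gh] /= fg.
have e : f = g by apply: functional_extensionality.
case: _ / e gt gh => gt.
(* The hom inequality mentions the type equality through its cast, so the two type equalities are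
   identified while it is still in the goal. *)
rewrite (proof_irrelevance _ gt ft) => gh.
by rewrite (proof_irrelevance _ fh gh).
Qed.

End Extensionality.

Section DistAdjunction.
Variable Q : quantaloid.

(** The unit is required on the diagonal only: acting by [qhom x x'] recovers the full inequality
    between distributors. *)
Definition dist_adjoint (A B : qcat Q) (phi : dist A B) (psi : dist B A) :=
  (forall x, idq (qtype x) <= dcomp psi phi x x) /\
  (forall y y', dcomp phi psi y y' <= qhom y y').

(** Both sides are right adjoint to precomposition with [psi]. The unit inserts [psi] followed by
    [phi] after identities, and the counit contracts [eta o phi o psi] to [eta]. *)
Lemma dlimp_adjoint (A B C : qcat Q) (phi : dist A B) (psi : dist B A)
    (eta : dist B C) :
  dist_adjoint phi psi -> dlimp eta psi = dcomp eta phi.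
Proof.
case=> unit counit; apply: dist_ext => x z; apply: arr_le_anti.
- rewrite -[dlimp eta psi x z]compq1.
  apply: (arr_le_trans (comp_le2l _ (unit x))); apply: sup_compr => y.
  rewrite compA.
  apply: (@arr_le_trans _ _ _ _ (eta y z \o phi x y)); last first.
    exact: (sup_ub (fun y => eta y z \o phi x y)).
  apply: comp_le2r; apply/limpP.
  exact: (inf_lb (fun y => limp (eta y z) (psi y x))).
- apply: inf_greatest => y; apply/limpP; apply: sup_compl => y'.
  rewrite -compA; apply: (arr_le_trans _ (dist_actr eta y y' z)).
  apply: comp_le2l; apply: (arr_le_trans _ (counit y y')).
  exact: (sup_ub (fun x => phi x y' \o psi y x)).
Qed.

(** Dually, both sides are right adjoint to postcomposition with [phi]. *)
Lemma drimp_adjoint (A B C : qcat Q) (phi : dist A B) (psi : dist B A)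
    (eta : dist C B) :
  dist_adjoint phi psi -> drimp phi eta = dcomp psi eta.
Proof.
case=> unit counit; apply: dist_ext => z x; apply: arr_le_anti.
- rewrite -[drimp phi eta z x]comp1q.
  apply: (arr_le_trans (comp_le2r _ (unit x))); apply: sup_compl => y.
  rewrite -compA.
  apply: (@arr_le_trans _ _ _ _ (psi y x \o eta z y)); last first.
    exact: (sup_ub (fun y => psi y x \o eta z y)).
  apply: comp_le2l; apply/rimpP.
  exact: (inf_lb (fun y => rimp (phi x y) (eta z y))).
- apply: inf_greatest => y; apply/rimpP; apply: sup_compr => y'.
  rewrite compA; apply: (arr_le_trans _ (dist_actl eta z y' y)).
  apply: comp_le2r; apply: (arr_le_trans _ (counit y' y)).
  exact: (sup_ub (fun x => phi x y \o psi y' x)).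
Qed.

Lemma graph_cograph_adjoint (A B : qcat Q) (F : qfunctor A B) :
  dist_adjoint (graph F) (cograph F).
Proof.
split=> [x|y y'].
(* The join over [B] is bounded below by its term at [F x], which up to casts is [qhom (F x) (F x)]
   composed with itself. *)
- apply: (@arr_le_trans _ _ _ _ (cograph F (F x) x \o graph F x (F x))).
    rewrite castarr_comp -(castarr_id (qfun_type F x)); apply: castarr_le.
    rewrite -[idq _]comp1q; apply: (arr_le_trans (comp_le2l _ (qhom_id _))).
    exact: comp_le2r (qhom_id _).
  exact: (sup_ub (fun y => cograph F y x \o graph F x y)).
(* The two casts meet at the type of [x] and cancel, leaving composition in [B] through [F x]. *)
- by apply: sup_least => x; rewrite castarr_comp; apply: qhom_comp.
Qed.

End DistAdjunction.

Section InducedAdjunctions.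
Variables (Q : quantaloid) (A B : qcat Q) (phi : dist A B).

Lemma upstar_lowstar_adjoint : qadjoint (dist_upstar phi) (dist_lowstar phi).
Proof.
(* These functors preserve types definitionally, so the cast in [qle] vanishes. *)
split=> mu; exists erefl.
- apply/(@psh_homP _ _ mu (dist_ran_fun phi (dist_pre_fun phi mu))) => y.
  rewrite comp1q; apply: inf_greatest => x; apply/limpP.
  exact: (sup_ub (fun y => mu y tt \o phi x y)).
- apply/(@psh_homP _ _ (dist_pre_fun phi (dist_ran_fun phi mu)) mu) => x.
  rewrite comp1q; apply: sup_least => y; apply/limpP.
  exact: (inf_lb (fun x => limp (mu x tt) (phi x y))).
Qed.

(** Pointwise, the implication is right adjoint to composition; the order on copresheaves is
    reversed, so here it becomes the left adjoint. *)
Lemma lowdagger_updagger_adjoint :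
  qadjoint (dist_lowdagger phi) (dist_updagger phi).
Proof.
split=> mu; exists erefl.
- apply/(@copsh_homP _ _ mu (dist_post_fun phi (dist_lift_fun phi mu))) => y.
  rewrite compq1; apply: sup_least => x; apply/rimpP.
  exact: (inf_lb (fun y => rimp (phi x y) (mu tt y))).
- apply/(@copsh_homP _ _ (dist_lift_fun phi (dist_post_fun phi mu)) mu) => x.
  rewrite compq1; apply: inf_greatest => y; apply/rimpP.
  exact: (sup_ub (fun x => phi x y \o mu tt x)).
Qed.

End InducedAdjunctions.

Theorem theorem6p2p4 (Q : quantaloid) (A B : qcat Q) (F : qfunctor A B) :
  (image F = dist_upstar (cograph F) /\
   qadjoint (dist_upstar (cograph F)) (dist_lowstar (cograph F)) /\
   dist_lowstar (cograph F) = preimage F /\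
   preimage F = dist_upstar (graph F) /\
   qadjoint (dist_upstar (graph F)) (dist_lowstar (graph F))) /\
  (qadjoint (dist_lowdagger (cograph F)) (dist_updagger (cograph F)) /\
   dist_updagger (cograph F) = copreimage F /\
   copreimage F = dist_lowdagger (graph F) /\
   qadjoint (dist_lowdagger (graph F)) (dist_updagger (graph F)) /\
   dist_updagger (graph F) = coimage F).
Proof.
have adjF := graph_cograph_adjoint F.
(* The image functors are convertible to the functors induced by graph and cograph; only the two
   equalities with implications need an argument. *)
split; split; [by []| | |].
- split; first exact: upstar_lowstar_adjoint.
  split; last by split=> //; apply: upstar_lowstar_adjoint.
  apply: qfunctor_ext => mu.
  by congr Psh; apply: (dlimp_adjoint mu adjF).
- exact: lowdagger_updagger_adjoint.
- split=> //; split; last by split=> //; apply: lowdagger_updagger_adjoint.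
  apply: qfunctor_ext => lam.
  by congr Copsh; rewrite -(drimp_adjoint lam adjF).
Qed.
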